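(* Let $\mathbf{k}\subset F$ be a finite extension of degree $n$ of subfields of $\mathbb{C}$, let $\alpha\in F$ be a generator, $F=\mathbf{k}(\alpha)$, with minimal polynomial $f(x)=x^n+a_{n-1}x^{n-1}+\dots+a_0$ over $\mathbf{k}$, so that $F\cong\mathbf{k}[x]/(f(x))$, and let $$w(x)=\frac{1}{n+1}x^{n+1}+\frac{a_{n-1}}{n}x^n+\dots+a_0x\in\mathbf{k}[x],$$ so that $w'(x)=f(x)$ and $F$ is the Jacobi algebra $\mathbf{k}[x]/(w'(x))$ of $w$. Then for all $p(x)\in\mathbf{k}[x]$ $$\mathrm{tr}_{F/\mathbf{k}}(p(x))=\mathrm{tr}_{\mathsf{Gr}}(w''(x)\,p(x)).$$
   Context: $\mathrm{tr}_{F/\mathbf{k}}:F\to\mathbf{k}$ is the field extension trace: $\mathrm{tr}_{F/\mathbf{k}}(a)$ is the trace of the $\mathbf{k}$-linear map $F\to F$, $b\mapsto ab$; $\mathrm{tr}_{F/\mathbf{k}}(p(x))$ means its value on the class of $p(x)$ in $\mathbf{k}[x]/(f(x))\cong F$ (i.e. on $p(\alpha)$). $\mathrm{tr}_{\mathsf{Gr}}$ is the Grothendieck residue trace of the Jacobi algebra of the one-variable potential $w$: $$\mathrm{tr}_{\mathsf{Gr}}(p(x))=\frac{1}{2\pi i}\int_{|f(x)|=R}\frac{p(x)}{f(x)}\,dx,\qquad R\gg0,$$ the contour enclosing all roots of $f=w'$ (these roots are simple). *)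

(* Defs.v *)
From HB Require Import structures.
From mathcomp Require Import all_boot all_order all_algebra all_field.
From mathcomp Require Import all_classical all_reals all_analysis.
From mathcomp Require Import complex.

Set Implicit Arguments.
Unset Strict Implicit.
Unset Printing Implicit Defensive.

Import Order.TTheory GRing.Theory Num.Theory numFieldNormedType.Exports.

Local Open Scope classical_set_scope.
Local Open Scope ring_scope.
Local Open Scope complex_scope.

(* The trace does not depend on the basis; vbasis {:V} is the library's chosen
   one. *)
Definition lf_trace (K : fieldType) (V : vectType K) (phi : 'End(V)) : K :=
  \tr (passmx.mxof (vbasis {:V}) (vbasis {:V}) phi).

Definition field_trace (k : fieldType) (F : fieldExtType k) (a : F) : k :=
  lf_trace (amull a).

Section Contours.
Variable R : realType.
Implicit Types (gamma : R -> R[i]) (g : R[i] -> R[i]) (f w p : {poly R[i]}).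

Definition re_path gamma : R -> R := fun t => complex.Re (gamma t).
Definition im_path gamma : R -> R := fun t => complex.Im (gamma t).

Definition velocity gamma (t : R) : R[i] :=
  derive1 (re_path gamma) t +i* derive1 (im_path gamma) t.

Definition C1_path gamma : Prop :=
  [/\ forall t, derivable (re_path gamma) t 1,
      forall t, derivable (im_path gamma) t 1,
      continuous (derive1 (re_path gamma)) &
      continuous (derive1 (im_path gamma))].

Definition contour_integral gamma g : R[i] :=
  let h t := g (gamma t) * velocity gamma t in
  Rintegral lebesgue_measure `[0, 1] (fun t => complex.Re (h t)) +i*
  Rintegral lebesgue_measure `[0, 1] (fun t => complex.Im (h t)).

(* The level curve |f| = r, traversed exactly once by a 1-periodic C^1 map
   (that is, parametrized by the circle R/Z).  Since
     d (arg f(gamma)) / dt = Im (f'(gamma) gamma' / f(gamma)),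
   the last condition orients the curve by increasing arg f, the usual
   orientation of the cycle in a Grothendieck residue; for large r, when the
   curve surrounds all the roots of f, it is the counterclockwise one.  It
   also makes the parametrization regular. *)
Record level_contour f (r : R) gamma : Prop := LevelContour {
  level_contour_C1 : C1_path gamma;
  level_contour_periodic : forall t, gamma (t + 1) = gamma t;
  level_contour_simple : {in `[0, 1[ &, injective gamma};
  level_contour_image :
    gamma @` [set` `[0, 1[] = [set z : R[i] | `|f.[z]| = r%:C];
  level_contour_oriented : forall t,
    0 < complex.Im (f^`().[gamma t] * velocity gamma t / f.[gamma t])
}.

(* "tr_Gr (p) = v" for the potential w: for all sufficiently large r the
   contour |w'| = r exists, and the residue integral of p / w' along it
   has the value v, whatever the parametrization. *)
Definition is_grothendieck_trace w p (v : R[i]) : Prop :=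
  \forall r \near +oo,
    (exists gamma, level_contour w^`() r gamma) /\
    forall gamma, level_contour w^`() r gamma ->
      (0 +i* (2 * pi))^-1 *
        contour_integral gamma (fun z => p.[z] / w^`().[z]) = v.

End Contours.

(* Main.v *)
(* On a contour |f| = r with r large, f'p/f is, for f = prod_a (x - a), the sum
   over the roots of (p(x) - p(a)) / (x - a), which has a polynomial primitive,
   and of p(a) / (x - a).  So the residue integral is the sum of the p(a) as soon
   as the contour winds once around every root, and this sum is the trace of
   p(alpha), since f is the characteristic polynomial of multiplication by alpha.

   Everything about the contour follows from Re (z f'(z) / f(z)) > 0 for z
   outside a disc containing the roots.  There |f| increases along rays, so the
   level curve is star-shaped: it is parametrized by the polar angle, by implicit
   differentiation of the radius.  Conversely, along any oriented parametrization
   the polar angle is strictly increasing; if it grew by more than 2 pi, the curve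
   would come back to its initial ray, hence to its initial point, too early. *)

Require Import Defs.
From HB Require Import structures.
From mathcomp Require Import all_boot all_order all_algebra all_field.
From mathcomp Require Import all_classical all_reals all_analysis.
From mathcomp Require Import complex.
From mathcomp Require Import ring lra.

Set Implicit Arguments.
Unset Strict Implicit.
Unset Printing Implicit Defensive.

Import Order.TTheory GRing.Theory Num.Theory numFieldNormedType.Exports.

Local Open Scope ring_scope.

(** * The complex numbers as pairs of reals, and paths *)

Section ComplexParts.
Local Open Scope complex_scope.
Variable R : realType.
Implicit Types x y z : R[i].

Lemma ReCD x y : complex.Re (x + y) = complex.Re x + complex.Re y.
Proof. by case: x; case: y. Qed.
Lemma ImCD x y : complex.Im (x + y) = complex.Im x + complex.Im y.
Proof. by case: x; case: y. Qed.
Lemma ReCN x : complex.Re (- x) = - complex.Re x. Proof. by case: x. Qed.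
Lemma ImCN x : complex.Im (- x) = - complex.Im x. Proof. by case: x. Qed.
Lemma ReCM x y :
  complex.Re (x * y) = complex.Re x * complex.Re y - complex.Im x * complex.Im y.
Proof. by case: x; case: y. Qed.
Lemma ImCM x y :
  complex.Im (x * y) = complex.Re x * complex.Im y + complex.Im x * complex.Re y.
Proof. by case: x => ? ?; case: y. Qed.
Lemma ReC_sum (I : Type) (s : seq I) (F : I -> R[i]) :
  complex.Re (\sum_(i <- s) F i) = \sum_(i <- s) complex.Re (F i).
Proof. by apply: big_morph => // x y; exact: ReCD. Qed.

Definition sqn z := complex.Re z ^+ 2 + complex.Im z ^+ 2.

Lemma sqn_ge0 z : 0 <= sqn z.
Proof. by rewrite addr_ge0 ?sqr_ge0. Qed.

Lemma sqn_gt0 z : (0 < sqn z) = (z != 0).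
Proof.
rewrite lt_neqAle sqn_ge0 andbT eq_sym paddr_eq0 ?sqr_ge0 // !sqrf_eq0.
by case: z => a b; rewrite eq_complex.
Qed.

Lemma sqnM x y : sqn (x * y) = sqn x * sqn y.
Proof. by rewrite /sqn ReCM ImCM; ring. Qed.

Lemma sqn_real (a : R) : sqn a%:C%C = a ^+ 2.
Proof. by rewrite /sqn /= expr0n addr0. Qed.

Lemma sqn_prod (s : seq R[i]) (F : R[i] -> R[i]) :
  sqn (\prod_(i <- s) F i) = \prod_(i <- s) sqn (F i).
Proof.
apply: big_morph; first exact: sqnM.
by rewrite /sqn /= expr1n expr0n addr0.
Qed.

Lemma normr_eq_sqn z (r : R) : 0 <= r -> `|z| = r%:C%C <-> sqn z = r ^+ 2.
Proof.
move=> r0; rewrite normc_def; split=> [[<-]|szr].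
  by rewrite sqr_sqrtr ?sqn_ge0.
by rewrite -/(sqn z) szr sqrtr_sqr ger0_norm.
Qed.

Lemma ReCV z : complex.Re z^-1 = complex.Re z / sqn z.
Proof. by case: z. Qed.
Lemma ImCV z : complex.Im z^-1 = - complex.Im z / sqn z.
Proof. by case: z => a b; rewrite mulNr. Qed.

Lemma ReCdiv x y :
  complex.Re (x / y) =
  (complex.Re x * complex.Re y + complex.Im x * complex.Im y) / sqn y.
Proof. by rewrite ReCM ReCV ImCV; ring. Qed.
Lemma ImCdiv x y :
  complex.Im (x / y) =
  (complex.Im x * complex.Re y - complex.Re x * complex.Im y) / sqn y.
Proof. by rewrite ImCM ReCV ImCV; ring. Qed.

Lemma eq_ReIm x y :
  complex.Re x = complex.Re y -> complex.Im x = complex.Im y -> x = y.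
Proof. by case: x => a b; case: y => c d /= -> ->. Qed.

Definition cexp z : R[i] :=
  (expR (complex.Re z) * cos (complex.Im z)) +i*
  (expR (complex.Re z) * sin (complex.Im z)).

Lemma cexpD x y : cexp (x + y) = cexp x * cexp y.
Proof.
by apply: eq_ReIm; rewrite ?ReCM ?ImCM /= ReCD ImCD expRD ?sinD ?cosD; ring.
Qed.

Lemma cexp0 : cexp 0 = 1.
Proof. by rewrite /cexp /= expR0 cos0 sin0 mul1r mulr0. Qed.

Lemma cexpNK z : cexp (- z) * cexp z = 1.
Proof. by rewrite -cexpD addNr cexp0. Qed.

Lemma sqn_cexp z : sqn (cexp z) = expR (complex.Re z) ^+ 2.
Proof.
by rewrite /sqn /= !exprMn -mulrDr cos2Dsin2 mulr1.
Qed.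

End ComplexParts.

Section PathCalculus.
Local Open Scope complex_scope.
Variable R : realType.
Implicit Types (g h : R -> R[i]) (t : R) (v : R[i]).

Definition cpath_continuous g t : Prop :=
  {for t, continuous (re_path g)} /\ {for t, continuous (im_path g)}.

Definition cpath_derive g t v : Prop :=
  is_derive t 1 (re_path g) (complex.Re v) /\
  is_derive t 1 (im_path g) (complex.Im v).

Lemma is_derive_continuous (f : R -> R) t (d : R) :
  is_derive t 1 f d -> {for t, continuous f}.
Proof.
by case=> dv _; apply: differentiable_continuous; exact/derivable1_diffP.
Qed.

Lemma cpath_derive_continuous g t v :
  cpath_derive g t v -> cpath_continuous g t.
Proof. by case=> /is_derive_continuous ? /is_derive_continuous ?. Qed.

Lemma cpath_continuous_cst c t : cpath_continuous (fun=> c) t.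
Proof. by split; exact: cst_continuous. Qed.

Lemma cpath_continuousD g h t : cpath_continuous g t -> cpath_continuous h t ->
  cpath_continuous (fun s => g s + h s) t.
Proof.
move=> [rg ig] [rh ih]; split.
  rewrite (_ : re_path _ = re_path g + re_path h); last first.
    by apply/funext => s; rewrite /re_path ReCD.
  exact: continuousD.
rewrite (_ : im_path _ = im_path g + im_path h); last first.
  by apply/funext => s; rewrite /im_path ImCD.
exact: continuousD.
Qed.

Lemma cpath_continuousM g h t : cpath_continuous g t -> cpath_continuous h t ->
  cpath_continuous (fun s => g s * h s) t.
Proof.
move=> [rg ig] [rh ih]; split.
  rewrite (_ : re_path _ = re_path g * re_path h - im_path g * im_path h).
    by apply: continuousB; apply: continuousM.
  by apply/funext => s; rewrite /re_path ReCM.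
rewrite (_ : im_path _ = re_path g * im_path h + im_path g * re_path h).
  by apply: continuousD; apply: continuousM.
by apply/funext => s; rewrite /im_path ImCM.
Qed.

Lemma cpath_continuous_conj g t : cpath_continuous g t ->
  cpath_continuous (fun s => ((g s)^*)%C) t.
Proof.
move=> [rg ig]; split.
  rewrite (_ : re_path _ = re_path g) //.
  by apply/funext => s; rewrite /re_path; case: (g s).
rewrite (_ : im_path _ = - im_path g); first exact: continuousN.
by apply/funext => s; rewrite /im_path fctE; case: (g s).
Qed.

Lemma cpath_continuousV g t : g t != 0 -> cpath_continuous g t ->
  cpath_continuous (fun s => (g s)^-1) t.
Proof.
move=> gt0 [rg ig].
have gn0 : re_path g t ^+ 2 + im_path g t ^+ 2 != 0.
  by have := gt0; rewrite -sqn_gt0 lt_neqAle eq_sym => /andP[].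
have cn : {for t, continuous (fun s => (re_path g s * re_path g s +
    im_path g s * im_path g s)^-1)}.
  apply: continuousV; first by rewrite -!expr2.
  by apply: continuousD; apply: continuousM.
split.
  rewrite (_ : re_path _ = fun s => re_path g s * (re_path g s * re_path g s +
    im_path g s * im_path g s)^-1); first exact: continuousM.
  by apply/funext => s; rewrite /re_path ReCV /sqn !expr2.
rewrite (_ : im_path _ = fun s => (- im_path g s) * (re_path g s * re_path g s +
    im_path g s * im_path g s)^-1).
  exact: continuousM (continuousN ig) cn.
by apply/funext => s; rewrite /im_path ImCV /sqn !expr2.
Qed.

Lemma cpath_continuous_horner (p : {poly R[i]}) g t : cpath_continuous g t ->
  cpath_continuous (fun s => p.[g s]) t.
Proof.
move=> cg; elim/poly_ind: p => [|p c IH].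
  rewrite (_ : (fun _ => _) = fun=> 0); first exact: cpath_continuous_cst.
  by apply/funext => s; rewrite horner0.
rewrite (_ : (fun _ => _) = fun s => p.[g s] * g s + c).
  apply: cpath_continuousD; last exact: cpath_continuous_cst.
  exact: cpath_continuousM.
by apply/funext => s; rewrite hornerMXaddC.
Qed.

Lemma cpath_derive_cst c t : cpath_derive (fun=> c) t 0.
Proof. by split; exact: is_derive_cst. Qed.

Lemma cpath_deriveD g h t v w : cpath_derive g t v -> cpath_derive h t w ->
  cpath_derive (fun s => g s + h s) t (v + w).
Proof.
move=> [rg ig] [rh ih]; split.
  rewrite (_ : re_path _ = re_path g + re_path h); last first.
    by apply/funext => s; rewrite /re_path ReCD.
  by rewrite ReCD; exact: is_deriveD.
rewrite (_ : im_path _ = im_path g + im_path h); last first.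
  by apply/funext => s; rewrite /im_path ImCD.
by rewrite ImCD; exact: is_deriveD.
Qed.

Lemma cpath_deriveM g h t v w : cpath_derive g t v -> cpath_derive h t w ->
  cpath_derive (fun s => g s * h s) t (v * h t + g t * w).
Proof.
move=> [rg ig] [rh ih]; split.
  rewrite (_ : re_path _ = re_path g * re_path h - im_path g * im_path h).
    apply: is_derive_eq (is_deriveB (is_deriveM rg rh) (is_deriveM ig ih)) _.
    by rewrite ReCD !ReCM /GRing.scale /= /re_path /im_path; ring.
  by apply/funext => s; rewrite /re_path ReCM.
rewrite (_ : im_path _ = re_path g * im_path h + im_path g * re_path h).
  apply: is_derive_eq (is_deriveD (is_deriveM rg ih) (is_deriveM ig rh)) _.
  by rewrite ImCD !ImCM /GRing.scale /= /re_path /im_path; ring.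
by apply/funext => s; rewrite /im_path ImCM.
Qed.

Lemma cpath_derive_eq g t v w : cpath_derive g t v -> v = w -> cpath_derive g t w.
Proof. by move=> ? <-. Qed.

Lemma cpath_derive_sum (I : eqType) (s : seq I) (F : I -> R -> R[i])
    (V : I -> R[i]) t :
  (forall i, i \in s -> cpath_derive (F i) t (V i)) ->
  cpath_derive (fun u => \sum_(i <- s) F i u) t (\sum_(i <- s) V i).
Proof.
elim: s => [|i s IH] dF.
  rewrite big_nil (_ : (fun _ => _) = fun=> 0); first exact: cpath_derive_cst.
  by apply/funext => u; rewrite big_nil.
rewrite big_cons (_ : (fun _ => _) = fun u => F i u + \sum_(j <- s) F j u).
  apply: cpath_deriveD; first by apply: dF; rewrite mem_head.
  by apply: IH => j js; apply: dF; rewrite inE js orbT.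
by apply/funext => u; rewrite big_cons.
Qed.

Lemma cpath_deriveN g t v : cpath_derive g t v ->
  cpath_derive (fun s => - g s) t (- v).
Proof.
move=> dg; have := cpath_deriveM (cpath_derive_cst (-1) t) dg.
rewrite mul0r add0r mulN1r (_ : (fun _ => _) = fun s => - g s) //.
by apply/funext => s; rewrite mulN1r.
Qed.

Lemma cpath_derive_conj g t v : cpath_derive g t v ->
  cpath_derive (fun s => ((g s)^*)%C) t (v^*)%C.
Proof.
move=> [rg ig]; split.
  rewrite (_ : re_path _ = re_path g); last first.
    by apply/funext => s; rewrite /re_path; case: (g s).
  by case: v rg {ig}.
rewrite (_ : im_path _ = - im_path g); last first.
  by apply/funext => s; rewrite /im_path fctE; case: (g s).
by apply: is_derive_eq (is_deriveN ig) _; case: v {rg ig}.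
Qed.

Lemma cpath_derive_horner (p : {poly R[i]}) g t v : cpath_derive g t v ->
  cpath_derive (fun s => p.[g s]) t (p^`().[g t] * v).
Proof.
move=> dg; elim/poly_ind: p => [|p c IH].
  rewrite (_ : (fun _ => _) = fun=> 0).
    by rewrite linear0 horner0 mul0r; exact: cpath_derive_cst.
  by apply/funext => s; rewrite horner0.
rewrite (_ : (fun _ => _) = fun s => p.[g s] * g s + c); last first.
  by apply/funext => s; rewrite hornerMXaddC.
apply: (cpath_derive_eq (cpath_deriveD (cpath_deriveM IH dg)
  (cpath_derive_cst c t))).
by rewrite derivMXaddC !hornerE; ring.
Qed.

Lemma cpath_derive_cexp g t v : cpath_derive g t v ->
  cpath_derive (fun s => cexp (g s)) t (v * cexp (g t)).
Proof.
move=> [rg ig].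
have de := is_derive1_comp (is_derive_expR (re_path g t)) rg.
have dc := is_derive1_comp (is_derive_cos (im_path g t)) ig.
have ds := is_derive1_comp (is_derive_sin (im_path g t)) ig.
split.
  rewrite (_ : re_path _ = (expR \o re_path g) * (cos \o im_path g)) //.
  apply: is_derive_eq (is_deriveM de dc) _.
  by rewrite ReCM /= /re_path /im_path /GRing.scale /=; ring.
rewrite (_ : im_path _ = (expR \o re_path g) * (sin \o im_path g)) //.
apply: is_derive_eq (is_deriveM de ds) _.
by rewrite ImCM /= /re_path /im_path /GRing.scale /=; ring.
Qed.

Lemma is_derive_sqn g t v : cpath_derive g t v ->
  is_derive t 1 (fun s => sqn (g s))
    (2 * (complex.Re v * complex.Re (g t) + complex.Im v * complex.Im (g t))).
Proof.
move=> [rg ig].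
rewrite (_ : (fun _ => _) = re_path g * re_path g + im_path g * im_path g).
  apply: is_derive_eq (is_deriveD (is_deriveM rg rg) (is_deriveM ig ig)) _.
  by rewrite /GRing.scale /= /re_path /im_path; ring.
by apply/funext => s; rewrite /sqn !expr2.
Qed.

Lemma continuous_sqn g t : cpath_continuous g t ->
  {for t, continuous (fun s => sqn (g s))}.
Proof.
move=> [rg ig].
rewrite (_ : (fun _ => _) = re_path g * re_path g + im_path g * im_path g).
  by apply: continuousD; apply: continuousM.
by apply/funext => s; rewrite /sqn !expr2.
Qed.

Lemma cpath_continuous_real (x : R -> R) t : {for t, continuous x} ->
  cpath_continuous (fun s => (x s)%:C) t.
Proof. by move=> cx; split=> //; exact: cst_continuous. Qed.

Lemma cpath_derive_real (x : R -> R) t (d : R) : is_derive t 1 x d ->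
  cpath_derive (fun s => (x s)%:C) t d%:C.
Proof. by move=> dx; split=> //; exact: is_derive_cst. Qed.

Lemma is_derive_ln_sqn g t v : cpath_derive g t v -> g t != 0 ->
  is_derive t 1 (fun s => ln (sqn (g s)) / 2) (complex.Re (v / g t)).
Proof.
move=> dg gt0.
have ds := is_derive_sqn dg.
have sn0 : 0 < sqn (g t) by rewrite sqn_gt0.
have dl := @is_derive1_comp R (@ln R) (fun s => sqn (g s)) t _ _
  (is_derive1_ln sn0) ds.
rewrite (_ : (fun _ => _) = 2^-1 \*: (@ln R \o (fun s => sqn (g s)))); last first.
  by apply/funext => s; rewrite mulrC.
apply: is_derive_eq (is_deriveZ _ dl) _; rewrite ReCdiv /GRing.scale /=.
by field; rewrite gt_eqF.
Qed.

Lemma is_derive_atan_arg g t v : cpath_derive g t v -> 0 < complex.Re (g t) ->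
  is_derive t 1 (fun s => atan (complex.Im (g s) / complex.Re (g s)))
    (complex.Im (v / g t)).
Proof.
move=> [rg ig] gt0.
have rn0 : re_path g t != 0 by rewrite gt_eqF.
have dV := is_deriveV rn0 rg.
have dq : is_derive t 1 (im_path g * (fun s => (re_path g s)^-1))
    ((complex.Im v * complex.Re (g t) - complex.Re v * complex.Im (g t)) /
      complex.Re (g t) ^+ 2).
  apply: is_derive_eq (is_deriveM ig dV) _.
  by rewrite /re_path /im_path /GRing.scale /=; field.
have da := is_derive1_comp (is_derive1_atan _) dq.
apply: (is_derive_eq da); rewrite ImCdiv /sqn /= /re_path /im_path /=.
rewrite [LHS](_ : _ = (complex.Im v * complex.Re (g t) -
  complex.Re v * complex.Im (g t)) / (complex.Re (g t) ^+ 2 *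
   (1 + (complex.Im (g t) / complex.Re (g t)) ^+ 2))).
  by congr (_ / _); field.
by rewrite mulrCA; congr (_ * _); rewrite [RHS]invfM mulrC.
Qed.

End PathCalculus.

(** * Primitives *)

Section RealFacts.
Variable R : realType.
Implicit Types (f F : R -> R) (a b t x : R).

Lemma continuous_primitive f :
  (forall t, {for t, continuous f}) ->
  exists F, forall t, 0 <= t <= 1 -> is_derive t 1 F (f t).
Proof.
move=> cf; exists (fun t => \int[lebesgue_measure]_(s in `[(-1), t]%classic) f s).
move=> t /andP[t0 t1].
have [|||dF vF] := @continuous_FTC1_closed R f (-1) t 2 _ _ _ (cf t).
- by lra.
- apply: continuous_compact_integrable; first exact: segment_compact.
  exact: continuous_subspaceT.
- by lra.
exact: DeriveDef dF (etrans (esym (derive1E _ _)) vF).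
Qed.

Lemma MVT_is_derive F f a b : a <= b ->
  (forall t, a <= t <= b -> is_derive t 1 F (f t)) ->
  exists2 c, a <= c <= b & F b - F a = f c * (b - a).
Proof.
move=> ab dF; have [||c] := @MVT_segment R F f a b ab.
- by move=> x /[!in_itv]/= /andP[ax xb]; apply: dF; rewrite !ltW.
- apply: continuous_in_subspaceT => x; rewrite inE /= in_itv /= => xab.
  exact: is_derive_continuous (dF x xab).
by rewrite in_itv /= => cab eqF; exists c.
Qed.

Lemma integral_primitive f F :
  (forall t, {for t, continuous f}) ->
  (forall t, 0 <= t <= 1 -> is_derive t 1 F (f t)) ->
  Rintegral lebesgue_measure `[0, 1]%classic f = F 1 - F 0.
Proof.
move=> cf dF; rewrite /Rintegral (@continuous_FTC2 R f F 0 1) //.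
- exact: continuous_subspaceT.
- have cF x : 0 <= x <= 1 -> {for x, continuous F}.
    by move=> /dF /is_derive_continuous.
  split.
  + move=> x /[!in_itv]/= /andP[/ltW x0 /ltW x1].
    by case: (dF x (introT andP (conj x0 x1))).
  + apply: cvg_at_right_filter; apply: cF; lra.
  + apply: cvg_at_left_filter; apply: cF; lra.
move=> x /[!in_itv]/= /andP[/ltW x0 /ltW x1]; rewrite derive1E.
by case: (dF x (introT andP (conj x0 x1))).
Qed.

Lemma cos_lt1 x : 0 < x < 2 * pi -> cos x < 1.
Proof.
move=> /andP[x0 x1].
have s0 : 0 < sin (x / 2) by apply: sin_gt0_pi; apply/andP; split; lra.
have -> : x = (x / 2) *+ 2 by lra.
rewrite cos_mulr2n cos2sin2.
have : 0 < sin (x / 2) ^+ 2 by rewrite exprn_gt0.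
by lra.
Qed.

Lemma unit_polar x y : x ^+ 2 + y ^+ 2 = 1 ->
  exists2 a, 0 <= a < 2 * pi & x = cos a /\ y = sin a.
Proof.
move=> xy1.
have p0 := pi_gt0 R.
have x1 : -1 <= x <= 1 by apply/andP; split; nra.
have a0 := acos_ge0 x1; have a1 := acos_lepi x1.
have sa : sin (acos x) = `|y|.
  by rewrite sin_acos // -sqrtr_sqr; congr Num.sqrt; lra.
have ca : cos (acos x) = x by apply: acosK; rewrite in_itv.
have [y0|y0] := leP 0 y.
  exists (acos x); first by apply/andP; split; lra.
  by rewrite sa ca ger0_norm.
have an0 : acos x != 0.
  by apply/eqP => a00; have := sa; rewrite a00 sin0 ltr0_norm //; lra.
have agt0 : 0 < acos x by rewrite lt_neqAle eq_sym an0.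
exists (2 * pi - acos x); first by apply/andP; split; lra.
rewrite mulr_natl cosB sinB cos2pi sin2pi ca sa ltr0_norm //; split; ring.
Qed.

End RealFacts.

Section PathIntegrals.
Variable R : realType.
Local Open Scope complex_scope.
Implicit Types (g h gamma : R -> R[i]).

Lemma cpath_derive0_cst g a b : a <= b ->
  (forall t, a <= t <= b -> cpath_derive g t 0) -> g b = g a.
Proof.
move=> ab dg; apply: eq_ReIm.
  have [|c _] := @MVT_is_derive R (re_path g) (fun=> 0) a b ab.
    by move=> t /dg[].
  by rewrite mul0r => /eqP; rewrite subr_eq0 => /eqP.
have [|c _] := @MVT_is_derive R (im_path g) (fun=> 0) a b ab.
  by move=> t /dg[].
by rewrite mul0r => /eqP; rewrite subr_eq0 => /eqP.
Qed.

Lemma contour_integral_primitive gamma (f : R[i] -> R[i]) g :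
  let h t := f (gamma t) * velocity gamma t in
  (forall t, cpath_continuous h t) ->
  (forall t, 0 <= t <= 1 -> cpath_derive g t (h t)) ->
  contour_integral gamma f = g 1 - g 0.
Proof.
move=> h ch dg; rewrite /contour_integral.
have iRe := integral_primitive (fun t => (ch t).1) (fun t t01 => (dg t t01).1).
have iIm := integral_primitive (fun t => (ch t).2) (fun t t01 => (dg t t01).2).
by apply: eq_ReIm; rewrite /= ?ReCD ?ImCD ?ReCN ?ImCN; [exact: iRe|exact: iIm].
Qed.

Lemma cpath_derive_velocity gamma t : C1_path gamma ->
  cpath_derive gamma t (velocity gamma t).
Proof.
move=> [dr di _ _]; split; rewrite /= derive1E; exact: derivableP.
Qed.

Lemma cpath_continuous_velocity gamma t : C1_path gamma ->
  cpath_continuous (velocity gamma) t.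
Proof. by move=> [_ _ cr ci]; split; [exact: cr|exact: ci]. Qed.

Lemma C1_path_derive gamma v :
  (forall t, cpath_derive gamma t (v t)) ->
  (forall t, cpath_continuous v t) ->
  C1_path gamma /\ velocity gamma = v.
Proof.
move=> dg cv.
have er : derive1 (re_path gamma) = re_path v.
  by apply/funext => t; rewrite derive1E; have [[]] := dg t.
have ei : derive1 (im_path gamma) = im_path v.
  by apply/funext => t; rewrite derive1E; have [_ []] := dg t.
split; last by apply/funext => t; apply: eq_ReIm; rewrite /= ?er ?ei.
split=> [t|t||]; rewrite ?er ?ei.
- by have [[]] := dg t.
- by have [_ []] := dg t.
- by move=> t; have [] := cv t.
- by move=> t; have [] := cv t.
Qed.

End PathIntegrals.

(** * High level curves of a split polynomial *)

Section LevelCurves.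
Variable R : realType.
Local Open Scope complex_scope.

Lemma ltr_prod_seq (I : eqType) (s : seq I) (F G : I -> R) : s != [::] ->
  (forall i, i \in s -> 0 < F i < G i) ->
  \prod_(i <- s) F i < \prod_(i <- s) G i.
Proof.
case: s => // i s _ FG; rewrite big_seq [ltRHS]big_seq ltr_prod //=.
  by rewrite mem_head.
by move=> j js; have /andP[/ltW -> ->] := FG _ js.
Qed.

Lemma horner_logderiv (K : fieldType) (s : seq K) (z : K)
    (f := \prod_(a <- s) ('X - a%:P)) :
  f.[z] != 0 -> f^`().[z] / f.[z] = \sum_(a <- s) (z - a)^-1.
Proof.
rewrite {}/f; elim: s => [|a s IH]; first by rewrite !big_nil derivC horner0 mul0r.
rewrite !big_cons derivM derivXsubC mul1r !(hornerXsubC, hornerM, hornerD).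
rewrite mulf_eq0 negb_or => /andP[za fz]; rewrite -(IH fz).
by field; rewrite fz za.
Qed.

Lemma sqnB_le (z a : R[i]) : sqn (z - a) <= 2 * (sqn z + sqn a).
Proof.
rewrite /sqn ReCD ImCD ReCN ImCN.
have := sqr_ge0 (complex.Re z + complex.Re a).
have := sqr_ge0 (complex.Im z + complex.Im a).
by lra.
Qed.

Lemma Re_conj_lt (z a : R[i]) : sqn a < sqn z ->
  complex.Re z * complex.Re a + complex.Im z * complex.Im a < sqn z.
Proof.
rewrite /sqn => az.
have := sqr_ge0 (complex.Re z - complex.Re a).
have := sqr_ge0 (complex.Im z - complex.Im a).
by lra.
Qed.

Variables (rs : seq R[i]) (M : R).
Hypotheses (rs_neq0 : rs != [::]) (M_ge1 : 1 <= M).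
Hypothesis rs_bound : forall a, a \in rs -> sqn a < M.
Let f := \prod_(a <- rs) ('X - a%:P).

Definition level_bound : R := \prod_(a <- rs) (4 * M).

Lemma level_bound_ge1 : 1 <= level_bound.
Proof.
apply: (big_ind (fun x => 1 <= x)) => // [x y|_ _]; first exact: mulr_ege1.
by have := M_ge1; lra.
Qed.

Lemma sqn_horner_roots z : sqn f.[z] = \prod_(a <- rs) sqn (z - a).
Proof.
rewrite /f horner_prod sqn_prod; apply: eq_bigr => a _.
by rewrite hornerXsubC.
Qed.

Lemma sqn_horner_le z : sqn z <= M -> sqn f.[z] <= level_bound.
Proof.
move=> zM; rewrite sqn_horner_roots /level_bound.
rewrite big_seq [leRHS]big_seq.
apply: ler_prod => a ars; rewrite sqn_ge0 /=.
by apply: (le_trans (sqnB_le _ _)); have := rs_bound ars; lra.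
Qed.

Lemma level_outside z : level_bound < sqn f.[z] -> M < sqn z.
Proof. by move=> Bz; rewrite ltNge; apply/negP => /sqn_horner_le; lra. Qed.

Lemma horner_outside_neq0 z : M < sqn z -> f.[z] != 0.
Proof.
move=> Mz; rewrite -rootE /f root_prod_XsubC.
by apply/negP => /rs_bound; lra.
Qed.

Lemma Re_logderiv_gt0 z : M < sqn z -> 0 < complex.Re (z * f^`().[z] / f.[z]).
Proof.
move=> Mz; rewrite -mulrA horner_logderiv ?horner_outside_neq0 //.
rewrite mulr_sumr ReC_sum big_seq.
have pos a : a \in rs -> 0 < complex.Re (z / (z - a)).
  move=> /rs_bound aM; have az : sqn a < sqn z by lra.
  have za : z - a != 0.
    by rewrite subr_eq0; apply/eqP => zE; move: az; rewrite zE ltxx.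
  rewrite ReCdiv divr_gt0 ?sqn_gt0 // ReCD ImCD ReCN ImCN.
  by have := Re_conj_lt az; rewrite /sqn; lra.
case: rs rs_neq0 pos => // a s _ pos.
rewrite -big_seq big_cons ltr_pwDl //; first by apply: pos; rewrite mem_head.
by rewrite big_seq; apply: sumr_ge0 => b bs; rewrite ltW // pos // inE bs orbT.
Qed.

Lemma sqn_horner_ray_lt z (l : R) : M < sqn z -> 1 < l ->
  sqn f.[z] < sqn f.[l%:C * z].
Proof.
move=> Mz l1; rewrite !sqn_horner_roots; apply: ltr_prod_seq => // a ars.
have az : sqn a < sqn z by have := rs_bound ars; lra.
have za : z - a != 0.
  by rewrite subr_eq0; apply/eqP => zE; move: az; rewrite zE ltxx.
rewrite sqn_gt0 za /= -subr_gt0.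
have -> : sqn (l%:C * z - a) - sqn (z - a) = (l - 1) * ((l + 1) * sqn z -
   2 * (complex.Re z * complex.Re a + complex.Im z * complex.Im a)).
  by rewrite /sqn !(ReCD, ImCD, ReCN, ImCN, ReCM, ImCM) /=; ring.
rewrite mulr_gt0 ?subr_gt0 //.
have := Re_conj_lt az; have : sqn z < l * sqn z.
  by rewrite ltr_pMl //; have := M_ge1; lra.
by lra.
Qed.

Lemma sqn_horner_ray_le z (l : R) : 0 < l <= 1 ->
  level_bound < sqn f.[z] -> sqn f.[l%:C * z] <= sqn f.[z].
Proof.
move=> /andP[l0 l1] Bz.
have [Bl|lB] := ltP level_bound (sqn f.[l%:C * z]); last first.
  exact: le_trans lB (ltW Bz).
have Ml := level_outside Bl.
have [->|ln1] := eqVneq l 1; first by rewrite mul1r.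
have lV : 1 < l^-1 by rewrite invf_gt1 // lt_neqAle ln1.
have := sqn_horner_ray_lt Ml lV; rewrite mulrA -rmorphM /= mulVf ?gt_eqF //.
by rewrite mul1r => /ltW.
Qed.

(* Outside the disc containing the roots |f| increases along every ray, so a
   high level curve is star-shaped about 0. *)
Lemma level_star_shaped z (l : R) : 0 < l ->
  level_bound < sqn f.[z] -> sqn f.[l%:C * z] = sqn f.[z] -> l = 1.
Proof.
move=> l0 Bz eq; have [l1|l1|//] := ltgtP l 1.
  have lV : 1 < l^-1 by rewrite invf_gt1.
  have Ml : M < sqn (l%:C * z) by apply: level_outside; rewrite eq.
  have := sqn_horner_ray_lt Ml lV; rewrite mulrA -rmorphM /= mulVf ?gt_eqF //.
  by rewrite mul1r eq ltxx.
by have := sqn_horner_ray_lt (level_outside Bz) l1; rewrite eq ltxx.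
Qed.

End LevelCurves.

(** * Winding number and residues *)

Lemma poly_primitive (K : fieldType) (q : {poly K}) :
  [pchar K] =i pred0 -> exists Q, Q^`() = q.
Proof.
move=> /pcharf0P K0; exists (\poly_(i < (size q).+1) (q`_i.-1 / i%:R)).
apply/polyP => i; rewrite coef_deriv coef_poly ltnS.
case: ltnP => [_|qi]; last by rewrite mul0rn nth_default.
by rewrite -[LHS]mulr_natr divfK // K0.
Qed.

Section ResidueTheorem.
Variable R : realType.
Local Open Scope complex_scope.

Lemma periodic_frac (T : Type) (g : R -> T) : (forall t, g (t + 1) = g t) ->
  forall t, exists2 s, 0 <= s < 1 & g t = g s.
Proof.
move=> g1 t.
have gn n s : g (s + n%:R) = g s.
  by elim: n => [|n IH]; rewrite ?addr0 // -natr1 addrA g1.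
exists (t - (Num.floor t)%:~R).
  have := floor_le_tmp t; have := floorD1_gt t.
  rewrite intrD; lra.
case: (Num.floor t) => n; first by rewrite -[in LHS](subrK n%:R t) gn.
by rewrite NegzE mulrNz opprK gn.
Qed.

Variables (rs : seq R[i]) (M : R).
Hypotheses (rs_neq0 : rs != [::]) (M_ge1 : 1 <= M).
Hypothesis rs_bound : forall a, a \in rs -> sqn a < M.
Let f := \prod_(a <- rs) ('X - a%:P).

Variables (r : R) (gamma : R -> R[i]).
Hypotheses (r_high : level_bound rs M < r) (cgamma : level_contour f r gamma).
Let v := velocity gamma.

Lemma level_sqr_high : level_bound rs M < r ^+ 2.
Proof.
by have := level_bound_ge1 rs M_ge1; rewrite expr2; have := r_high; nra.
Qed.

Lemma contour_level t : sqn f.[gamma t] = r ^+ 2.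
Proof.
have [s s01 ->] := periodic_frac (level_contour_periodic cgamma) t.
have r0 : 0 <= r by have := level_bound_ge1 rs M_ge1; have := r_high; lra.
apply/(normr_eq_sqn _ r0).
have := level_contour_image cgamma; rewrite seteqP => -[sub _].
by apply: sub; exists s => //; rewrite set_itvE.
Qed.

Lemma contour_outside t : M < sqn (gamma t).
Proof.
apply: (level_outside rs_bound).
by rewrite contour_level level_sqr_high.
Qed.

Lemma contour_neq0 t : gamma t != 0.
Proof. by rewrite -sqn_gt0; have := contour_outside t; have := M_ge1; lra. Qed.

Lemma contour_horner_neq0 t : f.[gamma t] != 0.
Proof. exact: (horner_outside_neq0 rs_bound (contour_outside t)). Qed.

Lemma derive_contour t : cpath_derive gamma t (v t).
Proof. exact: cpath_derive_velocity (level_contour_C1 cgamma). Qed.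

Lemma Re_logderiv_contour t :
  complex.Re (f^`().[gamma t] * v t / f.[gamma t]) = 0.
Proof.
have df := cpath_derive_horner f (derive_contour t).
have [_ <-] := is_derive_ln_sqn df (contour_horner_neq0 t).
rewrite (_ : (fun _ => _) = cst (ln (r ^+ 2) / 2)); last first.
  by apply/funext => s; rewrite contour_level.
by have [] := is_derive_cst (ln (r ^+ 2) / 2 : R) t 1.
Qed.

Lemma angular_velocity_gt0 t : 0 < complex.Im (v t / gamma t).
Proof.
set A := gamma t * f^`().[gamma t] / f.[gamma t].
have A0 : 0 < complex.Re A.
  by apply: (@Re_logderiv_gt0 _ _ M) => //; exact: contour_outside.
have An0 : A != 0 by apply/eqP => A00; move: A0; rewrite A00 ltxx.
have fz := contour_horner_neq0 t; have gz := contour_neq0 t.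
have f'z : f^`().[gamma t] != 0.
  by apply: contraNneq An0 => f'0; rewrite /A f'0 mulr0 mul0r.
have -> : v t / gamma t = f^`().[gamma t] * v t / f.[gamma t] / A.
  by rewrite /A; field; rewrite fz f'z gz.
rewrite ImCdiv Re_logderiv_contour mul0r subr0 divr_gt0 ?sqn_gt0 //.
by rewrite mulr_gt0 //; exact: (level_contour_oriented cgamma).
Qed.

Lemma cpath_continuous_contour t : cpath_continuous gamma t.
Proof. exact: cpath_derive_continuous (derive_contour t). Qed.

Lemma contour10 : gamma 1 = gamma 0.
Proof. by have := level_contour_periodic cgamma 0; rewrite add0r. Qed.

Lemma contour_angle : exists2 theta : R -> R,
  (forall t : R, 0 <= t <= 1 ->
    is_derive t 1 theta (complex.Im (v t / gamma t))) &
  theta 1 - theta 0 = 2 * pi.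
Proof.
have cw t : cpath_continuous (fun s => v s / gamma s) t.
  apply: cpath_continuousM.
    exact: cpath_continuous_velocity (level_contour_C1 cgamma).
  by apply: cpath_continuousV; [exact: contour_neq0|exact: cpath_continuous_contour].
have [theta dtheta] := continuous_primitive (fun t => (cw t).2).
exists theta => //.
pose l t := (ln (sqn (gamma t)) / 2) +i* theta t.
have dl t : 0 <= t <= 1 -> cpath_derive l t (v t / gamma t).
  move=> t01; split; last exact: dtheta.
  exact: is_derive_ln_sqn (derive_contour t) (contour_neq0 t).
have lift t : 0 <= t <= 1 -> gamma t = cexp (l t - l 0) * gamma 0.
  move=> /andP[t0 t1].
  have : gamma t * cexp (- l t) = gamma 0 * cexp (- l 0).
    apply: (@cpath_derive0_cst _ (fun s => gamma s * cexp (- l s)) _ _ t0).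
    move=> s /andP[s0 st].
    have s01 : 0 <= s <= 1 by rewrite s0 (le_trans st).
    apply: cpath_derive_eq (cpath_deriveM (derive_contour s)
      (cpath_derive_cexp (cpath_deriveN (dl s s01)))) _.
    by field; exact: contour_neq0.
  move=> /(congr1 (fun z => z * cexp (l t))); rewrite -mulrA cexpNK mulr1 => ->.
  by rewrite cexpD; ring.
have turn t : 0 <= t <= 1 -> theta t - theta 0 = 2 * pi -> gamma t = gamma 0.
  move=> t01 th; rewrite (lift t t01).
  have ce : cexp (l t - l 0) = (expR (complex.Re (l t - l 0)))%:C.
    apply: eq_ReIm; rewrite /cexp /= th mulr_natl ?cos2pi ?sin2pi ?mulr1 ?mulr0 //.
  rewrite ce (level_star_shaped rs_neq0 M_ge1 rs_bound (z := gamma 0) (expR_gt0 _)).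
  - by rewrite mul1r.
  - by rewrite contour_level level_sqr_high.
  by rewrite -ce -(lift t t01) !contour_level.
have zero01 : 0 <= (0 : R) <= 1 by rewrite lexx ler01.
have one01 : 0 <= (1 : R) <= 1 by rewrite lexx ler01.
have gt0 : 0 < theta 1 - theta 0.
  have [c _ ->] := MVT_is_derive ler01 dtheta.
  by rewrite subr0 mulr1; exact: angular_velocity_gt0.
have cos1 : cos (theta 1 - theta 0) = 1.
  have := lift 1 one01; rewrite contour10 => /(congr1 (fun z => z / gamma 0)).
  rewrite mulfV ?contour_neq0 // mulfK ?contour_neq0 // => /(congr1 (@complex.Re R)).
  by rewrite /= /l contour10 subrr expR0 mul1r.
have ge : 2 * pi <= theta 1 - theta 0.
  rewrite leNgt; apply/negP => lt; have := @cos_lt1 R (theta 1 - theta 0).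
  by rewrite gt0 lt cos1 ltxx => /(_ isT).
apply/eqP; rewrite eq_le ge andbT leNgt; apply/negP => gt.
have ct : ({within `[0, 1], continuous theta})%classic.
  apply: continuous_in_subspaceT => x; rewrite inE /= in_itv /= => x01.
  exact: is_derive_continuous (dtheta x x01).
have [|s /[!in_itv]/= s01 ths] := @IVT R theta 0 1 (theta 0 + 2 * pi) ler01 ct.
  have p0 := pi_gt0 R; apply/andP; split.
    by rewrite ge_min; apply/orP; left; lra.
  by rewrite le_max; apply/orP; right; lra.
have /turn gs : 0 <= s <= 1 by [].
have sn1 : s != 1 by apply/eqP => s1; move: ths gt; rewrite s1; lra.
have s01' : s \in `[0, 1[.
  by rewrite in_itv /= lt_neqAle sn1 /=; move: s01 => /andP[-> ->].
have z01' : (0 : R) \in `[0, 1[ by rewrite in_itv /= lexx ltr01.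
have /(level_contour_simple cgamma s01' z01') s0 : gamma s = gamma 0.
  by apply: gs; rewrite ths; ring.
by move: ths; rewrite s0; have := pi_gt0 R; lra.
Qed.

(* A logarithm of [gamma - a]: since [|a| < |gamma|], the argument of
   [(gamma - a) / gamma] is an arctangent. *)
Lemma contour_log a theta :
  (forall t : R, 0 <= t <= 1 ->
    is_derive t 1 theta (complex.Im (v t / gamma t))) ->
  theta 1 - theta 0 = 2 * pi -> a \in rs ->
  exists2 L : R -> R[i],
    forall t : R, 0 <= t <= 1 -> cpath_derive L t (v t / (gamma t - a)) &
    L 1 - L 0 = 0 +i* (2 * pi).
Proof.
move=> dtheta dth ars.
pose u t := (gamma t - a) * ((gamma t)^*)%C.
have az t : sqn a < sqn (gamma t).
  by apply: lt_trans (contour_outside t); exact: rs_bound.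
have za t : gamma t - a != 0.
  by rewrite subr_eq0; apply/eqP => zE; have := az t; rewrite zE ltxx.
have dga t : cpath_derive (fun s => gamma s - a) t (v t).
  apply: cpath_derive_eq (cpath_deriveD (derive_contour t)
    (cpath_derive_cst (- a) t)) _.
  by rewrite addr0.
have du t := cpath_deriveM (dga t) (cpath_derive_conj (derive_contour t)).
have u0 t : 0 < complex.Re (u t).
  have := Re_conj_lt (az t); rewrite /u /sqn ReCM ReCD ImCD ReCN ImCN.
  by case: (gamma t) => x y /=; lra.
exists (fun t => (ln (sqn (gamma t - a)) / 2) +i*
    (theta t + atan (complex.Im (u t) / complex.Re (u t)))); last first.
  by apply: eq_ReIm; rewrite /= /u contour10 ?subrr // -dth; ring.
move=> t t01; split; first exact: is_derive_ln_sqn (dga t) (za t).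
apply: is_derive_eq (is_deriveD (dtheta t t01)
  (is_derive_atan_arg (du t) (u0 t))) _.
have gz := contour_neq0 t.
have gzc : ((gamma t)^*)%C != 0 by rewrite conjc_eq0.
have -> : (v t * ((gamma t)^*)%C + (gamma t - a) * ((v t)^*)%C) /
   ((gamma t - a) * ((gamma t)^*)%C) = v t / (gamma t - a) +
     ((v t / gamma t)^*)%C.
  have -> : ((v t / gamma t)^*)%C = ((v t)^*)%C / ((gamma t)^*)%C.
    by rewrite -conjc_inv; exact: rmorphM.
  by field; rewrite gzc za.
by rewrite ImCD; case: (v t / gamma t) => x y /=; lra.
Qed.

Lemma contour_integral_logderiv (p : {poly R[i]}) :
  contour_integral gamma (fun z => (f^`() * p).[z] / f.[z]) =
  (0 +i* (2 * pi)) * \sum_(a <- rs) p.[a].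
Proof.
have [theta dtheta dth] := contour_angle.
have [Q QP] : exists Q : R[i] -> {poly R[i]},
    forall a, (Q a)^`() = (p - p.[a]%:P) %/ ('X - a%:P).
  have /choice[Q QP] := fun a => poly_primitive ((p - p.[a]%:P) %/ ('X - a%:P))
    (pchar_num R[i]).
  by exists Q.
have [L LP] : exists L : R[i] -> R -> R[i], forall a, a \in rs ->
    (forall t : R, 0 <= t <= 1 -> cpath_derive (L a) t (v t / (gamma t - a))) /\
    L a 1 - L a 0 = 0 +i* (2 * pi).
  have /choice[L LP] : forall a, exists La : R -> R[i], a \in rs ->
    (forall t : R, 0 <= t <= 1 -> cpath_derive La t (v t / (gamma t - a))) /\
    La 1 - La 0 = 0 +i* (2 * pi).
    move=> a; have [ars|_] := boolP (a \in rs); last by exists (fun=> 0).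
    by have [La] := contour_log dtheta dth ars; exists La.
  by exists L.
rewrite (@contour_integral_primitive _ _ _
  (fun t => \sum_(a <- rs) ((Q a).[gamma t] + p.[a] * L a t))).
- rewrite -sumrB mulr_sumr big_seq [RHS]big_seq; apply: eq_bigr => a ars.
  by rewrite contour10 -(LP a ars).2; ring.
- move=> t; apply: cpath_continuousM; last first.
    exact: cpath_continuous_velocity (level_contour_C1 cgamma).
  have cg := cpath_continuous_contour t.
  apply: cpath_continuousM; first exact: cpath_continuous_horner.
  apply: cpath_continuousV; first exact: contour_horner_neq0.
  exact: cpath_continuous_horner.
move=> t t01.
apply: cpath_derive_eq (cpath_derive_sum (V := fun a =>
   p.[gamma t] * (gamma t - a)^-1 * v t) _) _.
  move=> a ars; apply: cpath_derive_eq (cpath_deriveD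
    (cpath_derive_horner (Q a) (derive_contour t))
    (cpath_deriveM (cpath_derive_cst p.[a] t) ((LP a ars).1 t t01))) _.
  have za : gamma t - a != 0.
    rewrite subr_eq0; apply/eqP => zE.
    by have := rs_bound ars; rewrite -zE; have := contour_outside t; lra.
  have /(congr1 (fun q => q.[gamma t])) :
      p - p.[a]%:P = (p - p.[a]%:P) %/ ('X - a%:P) * ('X - a%:P).
    rewrite divpK // dvdp_XsubCl rootE !hornerE subrr; exact: eqxx.
  rewrite QP hornerD hornerN hornerC hornerM hornerXsubC.
  set q := (_ %/ _).[_] => /eqP; rewrite subr_eq => /eqP ->.
  by field.
rewrite -mulr_suml -mulr_sumr -horner_logderiv ?contour_horner_neq0 // hornerM.
by rewrite mulrA [p.[_] * _]mulrC.
Qed.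

End ResidueTheorem.

(** * Existence of the contour *)

Section LevelContourExists.
Variable R : realType.
Local Open Scope complex_scope.

Lemma horner_difference_quotient (p : {poly R[i]}) (y z : R -> R[i]) t :
  cpath_continuous y t -> cpath_continuous z t -> y t = z t ->
  exists q : R -> R[i], [/\ cpath_continuous q t, q t = p^`().[z t] &
    forall s, p.[y s] - p.[z s] = (y s - z s) * q s].
Proof.
move=> cy cz yz; elim/poly_ind: p => [|p c [q [cq qt qE]]].
  exists (fun=> 0); split; first exact: cpath_continuous_cst.
    by rewrite linear0 horner0.
  by move=> s; rewrite !horner0 subrr mulr0.
exists (fun s => q s * y s + p.[z s]); split.
- apply: cpath_continuousD; last exact: cpath_continuous_horner.
  exact: cpath_continuousM.
- by rewrite derivMXaddC !hornerE qt yz; ring.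
move=> s; rewrite !hornerMXaddC mulrDr mulrA -qE; ring.
Qed.

(* Implicit differentiation of [x], where [G] is the partial dependence on
   [t] and [K] the difference quotient in [x] of the level function. *)
Lemma is_derive_implicit (x G K : R -> R) (t D : R) :
  is_derive t 1 G D -> {for t, continuous K} -> K t != 0 ->
  (forall s, (x s - x t) * K s = G t - G s) ->
  is_derive t 1 x (- D / K t).
Proof.
move=> /is_derive1_caratheodory[g [gE cg <-]] cK K0 xK.
apply: (@near_eq_is_derive _ _ _ (fun s => x t - g s / K s * (s - t))).
  near=> s; have Ks : K s != 0.
    near: s; exact: (cvgr_neq0 (K t)).
  apply: (mulIf Ks); rewrite mulrBl; apply/eqP; rewrite -subr_eq0; apply/eqP.
  have := xK s; have := gE s; set gs := g s * _ => gsE xKs.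
  have -> : g s / K s * (s - t) * K s = gs by rewrite /gs; field.
  by rewrite -gsE; move: xKs; rewrite mulrBl; lra.
apply/is_derive1_caratheodory; exists (fun s => - (g s / K s)); split.
- by move=> s; rewrite subrr mulr0 subr0; ring.
- apply: continuousN; apply: continuousM => //; exact: continuousV.
by rewrite mulNr.
Unshelve. all: by end_near. Qed.

Definition circle (t : R) : R[i] := cexp (0 +i* (2 * pi * t)).

Lemma sqn_circle t : sqn (circle t) = 1.
Proof. by rewrite sqn_cexp /= expR0 expr1n. Qed.

Lemma circle_periodic t : circle (t + 1) = circle t.
Proof.
by rewrite /circle /cexp /= mulrDr mulr1 mulr_natl cosD2pi sinD2pi.
Qed.

Lemma derive_circle t : cpath_derive circle t ((0 +i* (2 * pi)) * circle t).
Proof.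
apply: cpath_derive_cexp; split; first exact: is_derive_cst.
apply: is_derive_eq (is_deriveZ (2 * pi) (is_derive_id t 1)) _.
by rewrite /GRing.scale /= mulr1.
Qed.

Lemma circle_inj : {in `[0, 1[ &, injective circle}.
Proof.
have lt_neq s t : 0 <= s -> s < t -> t < 1 -> circle s <> circle t.
  move=> s0 st t1; rewrite /circle /cexp /= expR0 !mul1r => -[ec es].
  have p0 := pi_gt0 R.
  have := @cos_lt1 R (2 * pi * t - 2 * pi * s).
  rewrite cosB ec es -!expr2 cos2Dsin2 ltxx => contra.
  by have /contra : 0 < 2 * pi * t - 2 * pi * s < 2 * pi by apply/andP; split; nra.
move=> s t /[!in_itv]/= /andP[s0 s1] /andP[t0 t1] e; case: (ltgtP s t) => // st.
  by case: (lt_neq s t).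
by case: (lt_neq t s).
Qed.

Lemma circle_surj z : z != 0 ->
  exists2 t, t \in `[0, 1[ & z = (Num.sqrt (sqn z))%:C * circle t.
Proof.
move=> z0; have s0 : 0 < sqn z by rewrite sqn_gt0.
set x := Num.sqrt _; have x0 : 0 < x by rewrite sqrtr_gt0.
have xx : x ^+ 2 = sqn z by rewrite sqr_sqrtr // ltW.
have [|a /andP[a0 a2] [ca sa]] :=
  @unit_polar R (complex.Re z / x) (complex.Im z / x).
  by rewrite !expr_div_n -mulrDl xx divff // gt_eqF.
have p0 := pi_gt0 R.
have p2 : 0 < 2 * pi :> R by lra.
exists (a / (2 * pi)).
  rewrite in_itv /=; apply/andP; split; last by rewrite ltr_pdivrMr // mul1r.
  by rewrite divr_ge0 // ltW.
rewrite /circle /cexp /= expR0 !mul1r.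
have -> : 2 * pi * (a / (2 * pi)) = a.
  by rewrite mulrC divfK // lt0r_neq0.
apply: eq_ReIm; rewrite ?ReCM ?ImCM /= -?ca -?sa; field; exact: lt0r_neq0 x0.
Qed.

Variables (rs : seq R[i]) (M : R).
Hypotheses (rs_neq0 : rs != [::]) (M_ge1 : 1 <= M).
Hypothesis rs_bound : forall a, a \in rs -> sqn a < M.
Let f := \prod_(a <- rs) ('X - a%:P).
Variable r : R.
Hypothesis r_high : level_bound rs M < r.

Lemma sqn_horner_ge z : 2 * (M + r ^+ 2) <= sqn z -> r ^+ 2 <= sqn f.[z].
Proof.
move=> zb; rewrite sqn_horner_roots.
have r1 : 1 <= r ^+ 2.
  by have := level_sqr_high M_ge1 r_high; have := level_bound_ge1 rs M_ge1; lra.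
have fac a : a \in rs -> r ^+ 2 <= sqn (z - a).
  move=> /rs_bound aM.
  have := sqnB_le (z - a) (- a); rewrite opprK subrK.
  have -> : sqn (- a) = sqn a by rewrite /sqn ReCN ImCN !sqrrN.
  by lra.
case: rs rs_neq0 fac => // a s _ fac; rewrite big_cons.
have fa := fac a (mem_head _ _).
have : 1 <= \prod_(b <- s) sqn (z - b).
  rewrite big_seq; apply: (big_ind (fun x => 1 <= x)) => //.
    by move=> x y; exact: mulr_ege1.
  by move=> b bs; apply: le_trans r1 _; apply: fac; rewrite inE bs orbT.
by move=> p1; apply: le_trans fa _; rewrite ler_peMr ?sqn_ge0.
Qed.

Lemma radius_exists u : sqn u = 1 ->
  exists2 x, 0 < x & sqn f.[x%:C * u] = r ^+ 2.
Proof.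
move=> u1; set b := 2 * (M + r ^+ 2).
have r2 := sqr_ge0 r; have b1 : 1 <= b by have := M_ge1; rewrite /b; lra.
have cg (x : R) : {for x, continuous (fun y : R => sqn f.[y%:C * u])}.
  apply: continuous_sqn; apply: cpath_continuous_horner.
  apply: cpath_continuousM; last exact: cpath_continuous_cst.
  by apply: (@cpath_continuous_real _ id); exact: cvg_id.
have lo : sqn f.[1%:C * u] <= r ^+ 2.
  apply: le_trans (ltW (level_sqr_high M_ge1 r_high)).
  by apply: sqn_horner_le => //; rewrite mul1r u1.
have hi : r ^+ 2 <= sqn f.[b%:C * u].
  apply: sqn_horner_ge; rewrite sqnM u1 sqn_real mulr1 -/b expr2.
  by rewrite ler_peMr //; lra.
have [||x /[!in_itv]/= /andP[x1 _] fx] :=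
  @IVT R (fun x : R => sqn f.[x%:C * u]) 1 b (r ^+ 2) b1.
- exact: continuous_subspaceT.
- by rewrite ge_min lo le_max hi orbT.
by exists x => //; lra.
Qed.

Lemma level_contour_exists : exists gamma, level_contour f r gamma.
Proof.
have /choice[rho rhoP] : forall u : R[i], exists x : R, sqn u = 1 ->
    0 < x /\ sqn f.[x%:C * u] = r ^+ 2.
  move=> u; have [u1|/eqP u1] := eqVneq (sqn u) 1; last by exists 0.
  by have [x x0 fx] := radius_exists u1; exists x.
pose x t := rho (circle t).
have x0 t : 0 < x t by have [] := rhoP _ (sqn_circle t).
pose gamma t := (x t)%:C * circle t.
have level t : sqn f.[gamma t] = r ^+ 2 by have [] := rhoP _ (sqn_circle t).
have high t : level_bound rs M < sqn f.[gamma t] by rewrite level level_sqr_high.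
have out t : M < sqn (gamma t) by exact: (level_outside rs_bound).
have scale y t : y%:C * circle t = (y / x t)%:C * gamma t.
  by rewrite /gamma mulrA -rmorphM /= divfK ?gt_eqF.
have uniq y t : 0 < y -> sqn f.[y%:C * circle t] = r ^+ 2 -> y = x t.
  move=> y0; rewrite scale -(level t) => eqf.
  have y1 : y / x t = 1.
    by apply: (level_star_shaped rs_neq0 M_ge1 rs_bound
      (divr_gt0 y0 (x0 t)) (high t)).
  by rewrite -[RHS]mul1r -y1 divfK ?gt_eqF.
have below y t : 0 < y -> sqn f.[y%:C * circle t] < r ^+ 2 -> y < x t.
  move=> y0; apply: contraTT; rewrite -!leNgt le_eqVlt => /predU1P[<-|xy].
    by rewrite -(level t).
  rewrite scale -(level t) ltW // (sqn_horner_ray_lt rs_neq0 M_ge1 rs_bound) //.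
  by rewrite ltr_pdivlMr ?mul1r.
have le_level y t : 0 < y -> y <= x t -> sqn f.[y%:C * circle t] <= r ^+ 2.
  move=> y0 yx; rewrite scale -(level t).
  apply: (sqn_horner_ray_le rs_neq0 M_ge1 rs_bound) => //.
  by rewrite divr_gt0 //= ler_pdivrMr ?mul1r.
have above y t : 0 < y -> r ^+ 2 < sqn f.[y%:C * circle t] -> x t < y.
  move=> y0; apply: contraTT; rewrite -!leNgt; exact: le_level.
have cc t : cpath_continuous circle t := cpath_derive_continuous (derive_circle t).
have cray y t : cpath_continuous (fun s => y%:C * circle s) t.
  by apply: cpath_continuousM => //; exact: cpath_continuous_cst.
have cx t : {for t, continuous x}.
  have cF y : {for t, continuous (fun s => sqn f.[y%:C * circle s])}.
    by apply: continuous_sqn; exact: cpath_continuous_horner.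
  apply/cvgrPdist_lt => e e0.
  pose y := Num.max (x t - e) (x t / 2).
  have yx : y < x t by rewrite gt_max; have := x0 t; lra.
  have y0 : 0 < y by rewrite lt_max; have := x0 t; lra.
  have Fy : sqn f.[y%:C * circle t] < r ^+ 2.
    rewrite lt_neqAle le_level 1?ltW // andbT; apply/eqP => /(uniq _ _ y0) yE.
    by move: yx; rewrite yE ltxx.
  have xe0 : 0 < x t + e by have := x0 t; lra.
  have Fe : r ^+ 2 < sqn f.[(x t + e)%:C * circle t].
    rewrite scale -(level t) (sqn_horner_ray_lt rs_neq0 M_ge1 rs_bound) //.
    by rewrite ltr_pdivlMr ?mul1r //; lra.
  near=> s.
  have ys : y < x s.
    apply: below => //; near: s; exact: (cvgr_lt _ (cF y)).
  have sy : x s < x t + e.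
    apply: above => //; near: s; exact: (cvgr_gt _ (cF (x t + e))).
  have : x t - e <= y by rewrite le_max lexx.
  by rewrite distrC ltr_distl; lra.
have cgamma t : cpath_continuous gamma t.
  by apply: cpath_continuousM => //; exact: cpath_continuous_real.
pose A t := gamma t * f^`().[gamma t] / f.[gamma t].
have A0 t : 0 < complex.Re (A t) by exact: (Re_logderiv_gt0 rs_neq0 rs_bound).
have fz t : f.[gamma t] != 0 by exact: (horner_outside_neq0 rs_bound).
pose w t : R[i] := (2 * pi * (complex.Im (A t) / complex.Re (A t))) +i* (2 * pi).
have dx (t : R) : is_derive t 1 x (x t * complex.Re (w t)).
  have [q [cq qt qE]] := @horner_difference_quotient f gamma
    (fun s => (x t)%:C * circle s) t (cgamma t) (cray _ t) erefl.
  pose h s := circle s * q s * ((f.[gamma s] + f.[(x t)%:C * circle s])^*)%C.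
  have ch : cpath_continuous h t.
    apply: cpath_continuousM; first exact: cpath_continuousM.
    apply: cpath_continuous_conj; apply: cpath_continuousD;
      exact: cpath_continuous_horner.
  have rr0 : 0 < r ^+ 2 by rewrite -(level t) sqn_gt0.
  have xC0 : (x t)%:C != 0 by apply/eqP => -[] xt0; have := x0 t; rewrite xt0 ltxx.
  have htE : complex.Re (h t) = 2 * r ^+ 2 * complex.Re (A t) / x t.
    rewrite (_ : h t = A t * (2 * r ^+ 2 / x t)%:C) ?ReCM /=; first by ring.
    have -> : (2 * r ^+ 2 / x t)%:C =
        2 * (f.[gamma t] * ((f.[gamma t])^*)%C) / (x t)%:C.
      have -> : f.[gamma t] * ((f.[gamma t])^*)%C = (r ^+ 2)%:C.
        rewrite -(level t); apply: eq_ReIm; rewrite /sqn ?ReCM ?ImCM;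
          case: (f.[gamma t]) => a b /=; ring.
      by rewrite !rmorphM fmorphV /= rmorph_nat.
    rewrite /h qt -/(gamma t) /A (rmorphD (@conjc R)) /gamma; field.
    by rewrite xC0 fz.
  have dG := is_derive_sqn (cpath_derive_horner f
    (cpath_deriveM (cpath_derive_cst (x t)%:C t) (derive_circle t))).
  apply: is_derive_eq (is_derive_implicit dG ch.1 _ _) _.
  - rewrite /re_path htE lt0r_neq0 // divr_gt0 //.
    by apply: mulr_gt0 => //; rewrite pmulr_rgt0.
  - move=> s; rewrite -/(gamma t) level -(level s).
    set y := f.[(x t)%:C * circle s].
    have -> : (x s - x t) * re_path h s = complex.Re ((x s - x t)%:C * h s).
      by rewrite ReCM /= mul0r subr0.
    have -> : (x s - x t)%:C * h s = (f.[gamma s] - y) * ((f.[gamma s] + y)^*)%C.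
      by have := qE s; rewrite /h -/y => ->; rewrite rmorphB /= /gamma; ring.
    by case: (f.[gamma s]) => a b; case: y => c d; rewrite ReCM /sqn /=; ring.
  pose u := f^`().[gamma t] *
    (0 * circle t + (x t)%:C * ((0 +i* (2 * pi)) * circle t)).
  rewrite /re_path htE -/(gamma t) -/u.
  have uE : u / f.[gamma t] = (0 +i* (2 * pi)) * A t.
    move: (fz t); rewrite /u /A; set F := f.[gamma t]; set F' := f^`().[gamma t].
    by rewrite /gamma => F0; field.
  have := ReCdiv u f.[gamma t]; rewrite uE level ReCM /= mul0r sub0r.
  move=> /(congr1 (fun y => y * r ^+ 2)); rewrite divfK ?lt0r_neq0 // => <-.
  have rn0 : r != 0 by apply: contraTneq rr0 => ->; rewrite expr0n ltxx.
  by field; rewrite rn0 (lt0r_neq0 (A0 t)) (lt0r_neq0 (x0 t)).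
have dgamma t : cpath_derive gamma t (gamma t * w t).
  apply: cpath_derive_eq (cpath_deriveM (cpath_derive_real (dx t))
    (derive_circle t)) _.
  have -> : w t = (complex.Re (w t))%:C + (0 +i* (2 * pi)).
    by apply: eq_ReIm; rewrite ?ReCD ?ImCD /= ?addr0 ?add0r.
  by rewrite ReCD /= addr0 /gamma rmorphM /=; ring.
have cw t : cpath_continuous (fun s => gamma s * w s) t.
  apply: cpath_continuousM => //.
  have [rA iA] : cpath_continuous A t.
    apply: cpath_continuousM; first apply: cpath_continuousM => //.
      exact: cpath_continuous_horner.
    by apply: cpath_continuousV => //; exact: cpath_continuous_horner.
  split; last exact: cst_continuous.
  apply: continuousM; first exact: cst_continuous.
  by apply: continuousM => //; apply: continuousV => //; rewrite gt_eqF // A0.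
have [C1g vg] := C1_path_derive dgamma cw.
exists gamma; split=> //.
- by move=> t; rewrite /gamma /x circle_periodic.
- move=> s t s01 t01 gst; apply: circle_inj => //.
  have xst : x s = x t.
    apply/eqP; rewrite -(@eqrXn2 _ 2) 1?ltW // -!sqn_real; apply/eqP.
    have := congr1 (@sqn R) gst; rewrite /gamma !sqnM !sqn_circle !mulr1.
    by [].
  move: gst; rewrite /gamma xst => /mulfI -> //.
  by apply/eqP => -[] xt0; have := x0 t; rewrite xt0 ltxx.
- have r0 : 0 <= r by have := level_bound_ge1 rs M_ge1; have := r_high; lra.
  apply/seteqP; split=> [_ [t _ <-]|z]; rewrite /= (normr_eq_sqn _ r0) //.
  move=> fzr; have zM : M < sqn z.
    by apply: (level_outside rs_bound); rewrite fzr level_sqr_high.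
  have z0 : z != 0 by rewrite -sqn_gt0; have := M_ge1; lra.
  have [t t01 zE] := circle_surj z0; exists t => //.
  rewrite /gamma -(uniq (Num.sqrt (sqn z)) t) ?sqrtr_gt0 ?sqn_gt0 //.
  by rewrite -zE.
move=> t; rewrite vg.
have -> : f^`().[gamma t] * (gamma t * w t) / f.[gamma t] = A t * w t.
  by rewrite /A; field.
rewrite ImCM /=; have p0 := pi_gt0 R.
have -> : complex.Re (A t) * (2 * pi) +
    complex.Im (A t) * (2 * pi * (complex.Im (A t) / complex.Re (A t))) =
    2 * pi * (complex.Re (A t) + complex.Im (A t) ^+ 2 / complex.Re (A t)).
  by ring.
apply: mulr_gt0; first by apply: mulr_gt0.
by rewrite ltr_pwDl // divr_ge0 ?sqr_ge0 // ltW.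
Unshelve. all: by end_near. Qed.

End LevelContourExists.

(** * The trace as a sum over the roots *)

Lemma trig_mx_mul (R : comNzRingType) n (A B : 'M[R]_n) :
  is_trig_mx A -> is_trig_mx B ->
  is_trig_mx (A *m B) /\ forall i, (A *m B) i i = A i i * B i i.
Proof.
move=> /is_trig_mxP tA /is_trig_mxP tB; split.
  apply/is_trig_mxP => i j ij; rewrite mxE big1 // => l _.
  have [il|li] := ltnP i l; first by rewrite tA ?mul0r.
  by rewrite tB ?mulr0 //; apply: leq_ltn_trans ij.
move=> i; rewrite mxE (bigD1 i) //= big1 ?addr0 // => l /negPf li.
have [il|] := ltnP i l; first by rewrite tA ?mul0r.
by rewrite leq_eqVlt val_eqE li /= => /tB ->; rewrite mulr0.
Qed.

Lemma trig_mx_horner (R : comNzRingType) n (A : 'M[R]_n.+1) (p : {poly R}) :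
  is_trig_mx A ->
  is_trig_mx (horner_mx A p) /\ forall i, horner_mx A p i i = p.[A i i].
Proof.
move=> tA; elim/poly_ind: p => [|p c [tp dp]].
  by rewrite rmorph0; split=> [|i]; rewrite ?mx0_is_trig // mxE horner0.
rewrite rmorphD rmorphM /= horner_mx_X horner_mx_C.
have [tM dM] := trig_mx_mul tp tA; split=> [|i].
  apply/is_trig_mxP => i j ij; rewrite mxE (is_trig_mxP tM _ _ ij).
  by rewrite mxE lt_eqF // mulr0n addr0.
by rewrite mxE dM dp mxE eqxx mulr1n hornerMXaddC.
Qed.

Lemma char_poly_conj (R : comUnitRingType) n (P A : 'M[R]_n) :
  P \in unitmx -> char_poly (P *m A *m invmx P) = char_poly A.
Proof.
move=> uP; rewrite /char_poly.
have -> : char_poly_mx (P *m A *m invmx P) =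
    map_mx polyC P *m char_poly_mx A *m map_mx polyC (invmx P).
  rewrite /char_poly_mx mulmxBr mulmxBl !map_mxM /=; congr (_ - _).
  by rewrite scalar_mxC -mulmxA -map_mxM mulmxV // map_mx1 mulmx1.
by rewrite !det_mulmx mulrAC -det_mulmx -map_mxM mulmxV // map_mx1 det1 mul1r.
Qed.

Lemma mxtrace_horner (C : numClosedFieldType) n (A : 'M[C]_n.+1) (rs : seq C)
    (p : {poly C}) :
  char_poly A = \prod_(z <- rs) ('X - z%:P) ->
  \tr (horner_mx A p) = \sum_(z <- rs) p.[z].
Proof.
move=> cA.
have [B C'|P uP] := @cotrigonalization C n.+1 [:: A].
  by rewrite !inE => /eqP-> /eqP->.
rewrite /= andbT => tT; have {}uP := unitarymx_unit uP.
have {tT} : is_trig_mx (P *m A *m invmx P).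
  by rewrite -(conjumx A uP); exact: tT.
set T := _ *m _ => tT.
have trA q : \tr (horner_mx A q) = \tr (horner_mx T q).
  by rewrite horner_mx_uconj // mxtrace_mulC mulKmx.
have [_ dT] := trig_mx_horner p tT.
have := char_poly_trig tT; rewrite char_poly_conj // cA => eqP.
rewrite trA /mxtrace.
have rsT : perm_eq rs [seq T i i | i <- enum 'I_n.+1].
  by apply: prod_XsubC_eq; rewrite eqP big_map big_enum.
by rewrite (perm_big _ rsT) big_map big_enum /=; apply: eq_bigr.
Qed.

Section FieldTrace.
Variables (k : fieldType) (F : fieldExtType k).
Let e := vbasis {:F}.
Let mulmx_of (b : F) := passmx.mxof e e (amull b).
Let e_basis : basis_of {:F} e. Proof. exact: vbasisP. Qed.

Let mulmx_ofP x b c : mulmx_of (x *: b + c) = x *: mulmx_of b + mulmx_of c.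
Proof. by rewrite -[RHS]passmx.mxof_linear -amull_is_linear. Qed.

Let mulmx_ofD b c : mulmx_of (b + c) = mulmx_of b + mulmx_of c.
Proof. by rewrite -[b in LHS]scale1r mulmx_ofP scale1r. Qed.

Let mulmx_ofZ x b : mulmx_of (x *: b) = x *: mulmx_of b.
Proof.
have mulmx_of0 : mulmx_of 0 = 0.
  by apply: (addrI (mulmx_of 0)); rewrite -mulmx_ofD !addr0.
by rewrite -[x *: b]addr0 mulmx_ofP mulmx_of0 addr0.
Qed.

Let mulmx_of1 : mulmx_of 1 = 1%:M.
Proof. by rewrite /mulmx_of amull1 passmx.mxof1 // (basis_free e_basis). Qed.

Let mulmx_ofM b c : mulmx_of (b * c) = mulmx_of b *m mulmx_of c.
Proof.
rewrite /mulmx_of -(passmx.mxof_comp e e e_basis); congr passmx.mxof.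
by apply/lfunP => u; rewrite comp_lfunE !lfunE /= mulrCA mulrA.
Qed.

Let mulmx_of_inj b : mulmx_of b = 0 -> b = 0.
Proof.
move=> /eqP; rewrite passmx.mxof_eq0 // => /eqP /lfunP /(_ 1).
by rewrite !lfunE /= mulr1.
Qed.

Lemma field_trace_horner (C : numClosedFieldType) (g : {rmorphism k -> C})
    (alpha : F) (f p : {poly k}) (rs : seq C) :
  size f = (\dim {:F}).+1 ->
  map_poly (in_alg F) f = minPoly 1%VS alpha ->
  map_poly g f = \prod_(z <- rs) ('X - z%:P) ->
  g (field_trace (map_poly (in_alg F) p).[alpha]) =
    \sum_(z <- rs) (map_poly g p).[z].
Proof.
rewrite /field_trace /lf_trace -/e -/(mulmx_of _).
move: mulmx_ofD mulmx_ofZ mulmx_of1 mulmx_ofM mulmx_of_inj.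
move: mulmx_of; case: (\dim {:F}) (adim_gt0 {:F}%AS) => // n _ rho.
move=> rhoD rhoZ rho1 rhoM rho_inj sf minf fact.
have rho0 : rho 0 = 0 by rewrite -(scale0r (1 : F)) rhoZ scale0r.
have rhoX q : rho (map_poly (in_alg F) q).[alpha] = horner_mx (rho alpha) q.
  elim/poly_ind: q => [|q c IH]; first by rewrite !rmorph0 horner0.
  rewrite !rmorphD !rmorphM /= map_polyX map_polyC /= hornerMXaddC rhoD rhoM.
  by rewrite IH horner_mx_X horner_mx_C rhoZ rho1 scalemx1.
have cf : char_poly (rho alpha) = f.
  apply/eqP; rewrite eq_sym -eqp_monic ?char_poly_monic //; last first.
    by rewrite -(map_monic (in_alg F)) minf monic_minPoly.
  rewrite -dvdp_size_eqp ?sf ?size_char_poly //.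
  rewrite -(dvdp_map (in_alg F)) minf minPoly_dvdp //.
    by apply/polyOverP => i; rewrite coef_map /= rpredZ // mem1v.
  apply/rootP/rho_inj; rewrite rhoX; exact: Cayley_Hamilton.
rewrite rhoX -trace_map_mx map_horner_mx.
by apply: mxtrace_horner; rewrite -map_char_poly cf.
Qed.

End FieldTrace.

(** * The Grothendieck trace *)

Lemma grothendieck_trace_hessian (R : realType) (w p : {poly R[i]})
    (rs : seq R[i]) :
  rs != [::] -> w^`() = \prod_(a <- rs) ('X - a%:P) ->
  is_grothendieck_trace w (w^`()^`() * p) (\sum_(a <- rs) p.[a]).
Proof.
move=> rs_neq0 w'E; set M := 1 + \sum_(a <- rs) sqn a.
have M_ge1 : 1 <= M by rewrite lerDl sumr_ge0 // => a _; exact: sqn_ge0.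
have rs_bound a : a \in rs -> sqn a < M.
  move=> ars; apply: (@le_lt_trans _ _ (\sum_(b <- rs) sqn b)); last first.
    by rewrite ltrDr.
  rewrite (big_rem a) //= lerDl sumr_ge0 // => b _; exact: sqn_ge0.
rewrite /is_grothendieck_trace w'E; near=> r.
have r_high : level_bound rs M < r.
  by near: r; apply: nbhs_pinfty_gt; exact: num_real.
split; first exact: level_contour_exists rs_neq0 M_ge1 rs_bound _ r_high.
move=> gamma cgamma.
rewrite (contour_integral_logderiv rs_neq0 M_ge1 rs_bound r_high cgamma) mulKf //.
rewrite eq_complex /= negb_and; apply/orP; right.
by rewrite lt0r_neq0 //; have := pi_gt0 R; lra.
Unshelve. all: by end_near. Qed.

Theorem mainTheorem10 (R : realType) (k : fieldType) (F : fieldExtType k)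
    (iota : {rmorphism F -> R[i]}) (n : nat) (alpha : F)
    (a : 'I_n -> k) (f w : {poly k})
    (hdeg : \dim {:F} = n)
    (hgen : <<1%VS; alpha>>%VS = {:F}%VS)
    (hf : f = 'X^n + \sum_(i < n) a i *: 'X^i)
    (hmin : map_poly (in_alg F) f = minPoly 1%VS alpha)
    (hw : w = n.+1%:R^-1 *: 'X^(n.+1)
              + \sum_(i < n) (a i / i.+1%:R) *: 'X^(i.+1))
    (p : {poly k}) :
  let embed : {poly k} -> {poly R[i]} := map_poly (iota \o in_alg F) in
  is_grothendieck_trace (embed w) (embed (w^`()^`() * p))
    (iota (in_alg F (field_trace (map_poly (in_alg F) p).[alpha]))).
Proof.
move=> embed; pose g : {rmorphism k -> R[i]} := iota \o in_alg F.
have nat_neq0 m : m.+1%:R != 0 :> k.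
  by rewrite -(fmorph_eq0 g) rmorph_nat pnatr_eq0.
have scaleXn (c : k) m : ((c / m.+1%:R) *: 'X^(m.+1))^`() = c *: 'X^m.
  by rewrite derivZ derivXn -scaler_nat scalerA divfK.
have w'E : w^`() = f.
  rewrite hw hf derivD linear_sum -[n.+1%:R^-1]mul1r scaleXn scale1r.
  by congr (_ + _); apply: eq_bigr => i _; exact: scaleXn.
have size_f : size f = (\dim {:F}).+1.
  rewrite -(size_map_poly (in_alg F)) hmin size_minPoly adjoin_degreeE hgen.
  by rewrite dimv1 divn1.
have monic_f : f \is monic.
  by rewrite -(map_monic (in_alg F)) hmin monic_minPoly.
have [rs] := closed_field_poly_normal (map_poly g f).
rewrite (monicP _) ?map_monic // scale1r => fact.
have rs_neq0 : rs != [::].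
  apply/eqP => rs0; have := size_f; rewrite -(size_map_poly g) fact rs0 big_nil.
  by rewrite size_poly1 => -[/eqP]; rewrite eq_sym -leqn0 leqNgt adim_gt0.
have embed_w' : (embed w)^`() = \prod_(z <- rs) ('X - z%:P).
  by rewrite /embed (deriv_map g) w'E -fact.
rewrite [iota _](field_trace_horner (g := g) p size_f hmin fact).
have -> : embed (w^`()^`() * p) = (embed w)^`()^`() * map_poly g p.
  by rewrite embed_w' -fact w'E /embed (rmorphM (map_poly g)) (deriv_map g).
exact: grothendieck_trace_hessian.
Qed.
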